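(* Let $X$ be a locally compact metric space (endowed with the metric $d$), let $p\geq 1$, and let $E$ be a vector sublattice of $\mathcal{F}(X)$ containing the constant functions and all the functions $d_{x}^{p}$ for $x\in X$. Let $(T_{n})_{n}$ be a sequence of sublinear and monotone operators from $E$ into $\mathcal{F}(X)$ which satisfies the following two conditions: (a) $\lim_{n\rightarrow\infty}T_{n}(1)=1$, uniformly on compact subsets of $X$; (b) $\lim_{n\rightarrow\infty}T_{n}(d_{x}^{p})(x)=0$, uniformly with respect to $x$ in compact subsets of $X$. Then, for all nonnegative $f\in E\cap C_{b}(X)$, $$\lim_{n\rightarrow\infty}T_{n}(f)=f\quad\text{uniformly on compact subsets of }X.$$ Moreover, this convergence holds for all functions $f\in E\cap C_{b}(X)$ when the operators $T_{n}$ are also translatable.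
   Context: $\mathcal{F}(X)$ is the vector lattice of all real-valued functions on $X$ with the pointwise order; $C_{b}(X)$ is the subspace of continuous bounded functions; $1$ is the constant function equal to one. For $x\in X$, $d_{x}:X\to\mathbb{R}$ is $d_{x}(y)=d(x,y)$, and $d_x^p$ is its pointwise $p$-th power. A vector sublattice is a linear subspace closed under pointwise maximum and minimum of two functions. A (not necessarily linear) operator $T:E\to\mathcal{F}(X)$ is called: - sublinear if $T(f+g)\leq T(f)+T(g)$ and $T(af)=aT(f)$ for all $f,g\in E$ and all real $a\geq 0$; - monotone if $f\leq g$ in $E$ implies $T(f)\leq T(g)$; - translatable if $T(f+\alpha\cdot 1)=T(f)+\alpha T(1)$ for all $f\in E$ and all real $\alpha\geq 0$. *)

(* Defs.v *)
From HB Require Import structures.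
From mathcomp Require Import all_boot all_order all_algebra.
From mathcomp Require Import all_classical all_reals all_analysis.

Set Implicit Arguments.
Unset Strict Implicit.
Unset Printing Implicit Defensive.

Import Order.TTheory GRing.Theory Num.Theory.
Import numFieldNormedType.Exports.

Local Open Scope classical_set_scope.
Local Open Scope ring_scope.

(* F(X) is the function type X -> R, with the pointwise linear structure and
   the pointwise order of the library (see lefP). *)

Definition vector_sublattice (R : realType) (X : Type) (E : set (X -> R)) :=
  [/\ submod_closed [in E],
      forall f g, E f -> E g -> E (f \max g)
    & forall f g, E f -> E g -> E (f \min g)].

Definition Cb (R : realType) (X : topologicalType) : set (X -> R) :=
  [set f | continuous f /\ bounded_fun f].
Arguments Cb : clear implicits.

Definition dist_pow (R : realType) (X : metricType R) (p : R) (x : X) : X -> R :=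
  fun y => mdist x y `^ p.

(* An operator E -> F(X) is represented by a total map on X -> R of which only
   the values on E matter: the predicates below never apply it outside E when
   E is a linear subspace containing the constants. *)

Definition sublinear_on (R : realType) (X : Type) (E : set (X -> R))
    (T : (X -> R) -> X -> R) :=
  (forall f g, E f -> E g -> (T (f + g) <= T f + T g)%O) /\
  (forall (a : R) f, 0 <= a -> E f -> T (a *: f) = a *: T f).

Definition monotone_on (R : realType) (X : Type) (E : set (X -> R))
    (T : (X -> R) -> X -> R) :=
  forall f g, E f -> E g -> (f <= g)%O -> (T f <= T g)%O.

Definition translatable_on (R : realType) (X : Type) (E : set (X -> R))
    (T : (X -> R) -> X -> R) :=
  forall f (a : R), E f -> 0 <= a ->
    T (f + a *: cst 1) = T f + a *: T (cst 1).

(* Main.v *)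
Require Import Defs.
From HB Require Import structures.
From mathcomp Require Import all_boot all_order all_algebra.
From mathcomp Require Import all_classical all_reals all_analysis.
From mathcomp Require Import lra.

Import Order.TTheory GRing.Theory Num.Theory.
Import numFieldNormedType.Exports.

Local Open Scope classical_set_scope.
Local Open Scope ring_scope.

(** This is a Korovkin argument in which the functions [d_x^p] play the role of
the quadratic test functions.

Let [f] be continuous and bounded and let [K] be compact.  Near [K] the
function [f] varies by less than [e] at distance less than some [d], and at
distance at least [d] its variation is absorbed by a multiple of the [p]-th
power of the distance.  Hence there is one constant [M] with
[|f x - f y| <= e + M d(x,y)^p] for all [x] in [K] and all [y] in [X]
([oscillation_le_dist_pow]).

Fix [x] in [K] and read this as two inequalities between functions of [y]:
[f <= f(x) 1 + e 1 + M d_x^p] and [f(x) 1 <= f + e 1 + M d_x^p].  If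
[f(x) >= 0], all scalar factors are nonnegative, so that a monotone sublinear
operator can be applied to both; its values at [x] satisfy
[|f(x) T1(x) - Tf(x)| <= e T1(x) + M T(d_x^p)(x)] ([sublinear_oscillation]).
With [T = T_n], the right-hand side is eventually of the order of [e] and
[f(x) T_n1(x)] is close to [f(x)], both uniformly on [K].

The sign of [f(x)] matters because sublinearity says nothing about
[T(-1)].  When the operators are translatable, [f] is replaced by the
nonnegative function [f + B 1], where [B] bounds [|f|], and
[B T_n1], which tends to [B], is subtracted afterwards. *)

Set Implicit Arguments.
Unset Strict Implicit.

Lemma cvg_compactP (R : realType) (X : topologicalType)
    (F : nat -> X -> R) (f : X -> R) :
  {family compact, F @ \oo --> f} <->
  forall K : set X, compact K -> forall e : R, 0 < e ->
    \forall n \near \oo, forall x, K x -> `|f x - F n x| < e.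
Proof.
split=> [/fam_cvgP cF K cK e e_gt0|cF].
  apply: (cF K cK [set h | forall x, K x -> `|f x - h x| < e]).
  apply/uniform_nbhs.
  exists [set xy | ball xy.1 e xy.2]; split=> //.
  exact: entourage_ball (PosNum e_gt0).
apply/fam_cvgP => K cK P /uniform_nbhs[U [entU UP]].
have [e /= e_gt0 eU] :
    exists2 e : R, 0 < e & [set xy | ball xy.1 e xy.2] `<=` U.
  by move: entU; rewrite -entourage_ballE.
apply: filterS (cF K cK e e_gt0) => n Fn; apply: UP => x Kx.
by apply: eU => /=; apply: Fn.
Qed.

(** Stronger than uniform continuity on [K], since [y] ranges over the whole
space: the estimate has to be turned into an inequality between functions on
[X].  The threshold [d] is uniform by compactness, because around each point
the same [d] serves all the points of a smaller ball. *)
Lemma compact_uniform_modulus (R : realType) (X : metricType R)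
    (f : X -> R) (K : set X) (e : R) :
  continuous f -> compact K -> 0 < e ->
  exists2 d : R, 0 < d &
    forall x y, K x -> mdist x y < d -> `|f x - f y| < e.
Proof.
move=> cf /compact_near_coveringP cK e_gt0.
have : \forall d \near 0^'+,
    K `<=` fun x => forall y, mdist x y < d -> `|f x - f y| < e.
  apply: cK => x Kx.
  have e2_gt0 : 0 < e / 2 by exact: divr_gt0.
  have /cvgrPdist_lt/(_ _ e2_gt0)/nbhs_ballP[r /= r_gt0 fr] := cf x.
  have r2_gt0 : 0 < r / 2 by exact: divr_gt0.
  exists (ball x (r / 2), [set d | d < r / 2]) => /=.
    by split; [exact: nbhsx_ballx|exact: nbhs_right_lt].
  case=> z d /= [xz dr] y zy.
  have zr : ball x r z.
    by apply: le_ball xz; rewrite ler_pdivrMr// ler_pMr ?ler1n.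
  have yr : ball x r y.
    apply: (ball_split xz); apply: le_ball (ltW dr) _ _.
    by rewrite ballEmdist.
  have := fr _ zr; have := fr _ yr => /=.
  rewrite !ltr_norml => /andP[? ?] /andP[? ?]; apply/andP; split; lra.
case=> r /= r_gt0 Kr; exists (r / 2); first exact: divr_gt0.
move=> x y Kx; apply: (Kr (r / 2)) => //; last exact: divr_gt0.
by rewrite /= sub0r normrN gtr0_norm ?divr_gt0// gtr_pMr ?invf_lt1 ?ltr1n.
Qed.

Lemma bounded_fun_gt0 (R : realType) (X : Type) (f : X -> R) :
  bounded_fun f -> exists2 B : R, 0 < B & forall x, `|f x| <= B.
Proof.
move=> [b [_ fb]]; exists (`|b| + 1); first by rewrite ltr_wpDl.
by move=> x; apply: fb => //; rewrite ltr_pwDr ?ler_norm.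
Qed.

(** If [d(x,y)] is at least the [d] of [compact_uniform_modulus], then
[(d(x,y) / d)^p >= 1], so the trivial bound [2 B] on the oscillation, where [B]
bounds [|f|], is at most [(2 B / d^p) d(x,y)^p]. *)
Lemma oscillation_le_dist_pow (R : realType) (X : metricType R)
    (p : R) (f : X -> R) (K : set X) (e : R) :
  0 <= p -> continuous f -> bounded_fun f -> compact K -> 0 < e ->
  exists2 M : R, 0 <= M &
    forall x y, K x -> `|f x - f y| <= e + M * dist_pow p x y.
Proof.
move=> p_ge0 cf /bounded_fun_gt0[B B_gt0 fB] cK e_gt0.
have [d d_gt0 fd] := compact_uniform_modulus cf cK e_gt0.
have dp_gt0 : 0 < d `^ p by exact: powR_gt0.
have M_ge0 : 0 <= 2 * B / d `^ p by rewrite divr_ge0 ?mulr_ge0 ?ltW.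
exists (2 * B / d `^ p) => // x y Kx; have [xyd|dxy] := ltP (mdist x y) d.
  by apply: le_trans (ltW (fd x y Kx xyd)) _; rewrite lerDl mulr_ge0 ?powR_ge0.
apply: le_trans (ler_normB _ _) _; apply: le_trans (lerD (fB x) (fB y)) _.
apply: ler_wpDl; first exact: ltW.
rewrite mulrAC ler_pdivlMr// -mulr2n -[B *+ 2]mulr_natl.
apply: ler_wpM2l; first by rewrite mulr_ge0 ?ltW.
by rewrite /dist_pow ge0_ler_powR// nnegrE ?(ltW d_gt0) ?mdist_ge0.
Qed.

(** The hypothesis amounts to [f <= c 1 + (e 1 + M g)] and
[c 1 <= f + (e 1 + M g)], to which the operator is applied; [c >= 0] allows the
scalar to be taken out of [T (c 1)]. *)
Lemma sublinear_oscillation (R : realType) (X : Type) (E : set (X -> R))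
    (T : (X -> R) -> X -> R) (f g : X -> R) (c e M : R) (x : X) :
  submod_closed [in E] -> sublinear_on E T -> monotone_on E T ->
  E (cst 1) -> E f -> E g ->
  0 <= c -> 0 <= e -> 0 <= M ->
  (forall y, `|c - f y| <= e + M * g y) ->
  `|c * T (cst 1) x - T f x| <= e * T (cst 1) x + M * T g x.
Proof.
move=> subE [subT homT] monT E1 Ef Eg c_ge0 e_ge0 M_ge0 fcg.
have [E0 EZD] := subE.
have EZ a h : E h -> E (a *: h).
  move=> Eh; have := EZD a h 0; rewrite !inE addr0; apply=> //.
  by move: E0; rewrite inE.
have ED h k : E h -> E k -> E (h + k).
  by move=> Eh Ek; have := EZD 1 h k; rewrite !inE scale1r; apply.
have leT h k : E h -> E k -> (forall y, h y <= k y) -> T h x <= T k x.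
  by move=> Eh Ek hk; have /lefP/(_ x) := monT _ _ Eh Ek (introT (lefP _ _) hk).
have TD h k : E h -> E k -> T (h + k) x <= T h x + T k x.
  by move=> Eh Ek; have /lefP/(_ x) := subT _ _ Eh Ek.
have TZ a h : 0 <= a -> E h -> T (a *: h) x = a * T h x.
  by move=> a_ge0 Eh; rewrite homT.
have Eeg : E (e *: cst 1 + M *: g) by apply: ED; apply: EZ.
have Teg : T (e *: cst 1 + M *: g) x <= e * T (cst 1) x + M * T g x.
  by rewrite -!TZ//; apply: TD; apply: EZ.
have lo : c * T (cst 1) x <= T f x + T (e *: cst 1 + M *: g) x.
  rewrite -TZ//; apply: le_trans (TD _ _ Ef Eeg).
  apply: leT; [exact: EZ|exact: ED|].
  move=> y; have := fcg y; rewrite ler_norml => /andP[_].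
  by rewrite !fctE /= /GRing.scale/= !mulr1 lerBlDl.
have hi : T f x <= c * T (cst 1) x + T (e *: cst 1 + M *: g) x.
  rewrite -TZ//; apply: le_trans (TD _ _ (EZ c _ E1) Eeg).
  apply: leT => //.
    by apply: ED => //; exact: EZ.
  move=> y; have := fcg y; rewrite ler_norml => /andP[+ _].
  by rewrite !fctE /= /GRing.scale/= !mulr1 lerNl opprB lerBlDl.
by rewrite ler_norml; apply/andP; split; lra.
Qed.

Unset Implicit Arguments.
Set Strict Implicit.

Theorem theorem4 (R : realType) (X : metricType R)
    (lcX : locally_compact [set: X])
    (p : R) (p_ge1 : 1 <= p)
    (E : set (X -> R)) (latE : vector_sublattice E)
    (cstE : forall c : R, E (cst c))
    (distE : forall x : X, E (dist_pow p x))
    (T : nat -> (X -> R) -> X -> R)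
    (sublinT : forall n, sublinear_on E (T n))
    (monoT : forall n, monotone_on E (T n))
    (T_one : {family compact, (fun n => T n (cst 1)) @ \oo --> (cst 1 : X -> R)})
    (T_dist : {family compact,
       (fun n => fun x : X => T n (dist_pow p x) x) @ \oo --> (cst 0 : X -> R)}) :
  (forall f : X -> R, E f -> Cb R X f -> (forall x, 0 <= f x) ->
     {family compact, (fun n => T n f) @ \oo --> f}) /\
  ((forall n, translatable_on E (T n)) ->
   forall f : X -> R, E f -> Cb R X f ->
     {family compact, (fun n => T n f) @ \oo --> f}).
Proof.
have subE : submod_closed [in E] by have [] := latE.
have E1 : E (cst 1) by [].
have {}T_one := (cvg_compactP _ _).1 T_one.
have {}T_dist := (cvg_compactP _ _).1 T_dist.
have nonneg f : E f -> Cb R X f -> (forall x, 0 <= f x) ->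
    {family compact, (fun n => T n f) @ \oo --> f}.
  move=> Ef [cf bf] f_ge0; apply/cvg_compactP => K cK e e_gt0.
  have [B B_gt0 fB] := bounded_fun_gt0 bf.
  have e4_gt0 : 0 < e / 4 by exact: divr_gt0.
  have p_ge0 : 0 <= p by exact: le_trans p_ge1.
  have [M M_ge0 osc] := oscillation_le_dist_pow p_ge0 cf bf cK e4_gt0.
  (* [h] is the accuracy required in both hypotheses: with it the three error
     terms [B h], [(e / 4) h] and [M h] add up to [e / 2], which together with
     the oscillation [e / 4] stays below [e]. *)
  pose D := B + e / 4 + M; pose h := e / 2 / D.
  have D_gt0 : 0 < D by rewrite ltr_wpDr// addr_gt0.
  have h_gt0 : 0 < h by rewrite !divr_gt0.
  have hD : B * h + e / 4 * h + M * h = e / 2.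
    by rewrite -!mulrDl mulrC divfK ?gt_eqF.
  near=> n; move=> x Kx.
  have T1 : `|1 - T n (cst 1) x| < h.
    by move: x Kx; near: n; exact: T_one.
  have Td : `|0 - T n (dist_pow p x) x| < h.
    by move: x Kx {T1}; near: n; exact: T_dist.
  have est := sublinear_oscillation x subE (sublinT n) (monoT n)
    E1 Ef (distE x) (f_ge0 x) (ltW e4_gt0) M_ge0 (fun y => osc x y Kx).
  have fT1 : `|f x - f x * T n (cst 1) x| <= B * h.
    by rewrite -{1}[f x]mulr1 -mulrBr normrM ler_pM//; exact: ltW.
  have T1h : e / 4 * T n (cst 1) x <= e / 4 * (1 + h).
    rewrite ler_wpM2l ?(ltW e4_gt0)//.
    by move: T1; rewrite ltr_norml => /andP[? _]; lra.
  have Tdh : M * T n (dist_pow p x) x <= M * h.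
    rewrite ler_wpM2l//.
    by move: Td; rewrite ltr_norml => /andP[? _]; lra.
  rewrite mulrDr mulr1 in T1h; move: est fT1; rewrite !ler_norml ltr_norml.
  by move=> /andP[? ?] /andP[? ?]; apply/andP; split; lra.
split=> // translT f Ef [cf bf].
have [B B_gt0 fB] := bounded_fun_gt0 bf.
have Eg : E (f + B *: cst 1).
  have [_ EZD] := subE.
  by have := EZD B (cst 1) f; rewrite !inE addrC; apply.
have gE x : (f + B *: cst 1) x = f x + B.
  by congr (_ + _); exact: mulr1.
have Cg : Cb R X (f + B *: cst 1).
  split.
    by move=> x; apply: cvgD; [exact: cf|exact: cvg_cst].
  exists (B + B); split=> [|b /ltW Bb x _]; first exact: num_real.
  rewrite /= gE; apply: le_trans Bb; apply: le_trans (ler_normD _ _) _.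
  by rewrite lerD// gtr0_norm.
have g_ge0 x : 0 <= (f + B *: cst 1) x.
  by rewrite gE; have := fB x; rewrite ler_norml => /andP[? _]; lra.
have Tg := (cvg_compactP _ _).1 (nonneg _ Eg Cg g_ge0).
apply/cvg_compactP => K cK e e_gt0.
have e2_gt0 : 0 < e / 2 by exact: divr_gt0.
have eB_gt0 : 0 < e / 2 / B by exact: divr_gt0.
near=> n; move=> x Kx.
have T1 : `|1 - T n (cst 1) x| < e / 2 / B.
  by move: x Kx; near: n; exact: T_one.
have : `|(f + B *: cst 1) x - T n (f + B *: cst 1) x| < e / 2.
  by move: x Kx {T1}; near: n; exact: Tg.
rewrite (translT n) ?(ltW B_gt0)// gE.
have {}T1 : `|B * (1 - T n (cst 1) x)| < e / 2.
  by rewrite normrM (gtr0_norm B_gt0) mulrC -ltr_pdivlMr.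
rewrite [X in `|_ - X|](_ : _ = T n f x + B * T n (cst 1) x)//.
move: T1; rewrite !ltr_norml => /andP[? ?] /andP[? ?]; apply/andP; split; lra.
Unshelve. all: by end_near.
Qed.
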